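(* Let $0<r<R$, $W=\{x\in\mathbb{R}^2: r<|x|<R\}$, and $c\in C^1(\overline W,(0,\infty))$. Let $\theta(x)=\arg(x)$ (that is, there is one spiral center, $N=1$, at $a_1=0$ with $m_1=1$). Let $u_0\in C^2(\overline W)$ with $D(u_0-\theta)\cdot\mathbf{n}=0$ on $\partial W$, let $u$ be the unique viscosity solution to $$\begin{cases} u_t =|D(u-\theta)| \left(\operatorname{div}\left(\frac{D(u-\theta)}{|D(u-\theta)|}\right)+c(x)\right) & \text{in } W\times(0,\infty), \\ D(u-\theta)\cdot \mathbf{n}=0 & \text{on } \partial W\times(0,\infty),\\ u(\cdot,0)=u_0 & \text{on } \overline W, \end{cases}$$ and let $S_c=\lim_{t\to\infty}\frac1t\max_{x\in\overline W}u(x,t)$. Then $$\min_{x\in\overline W}\frac{c(x)}{|x|}\le S_c\le\max_{x\in\overline W}\frac{c(x)}{|x|}.$$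
   Context: $\mathbf{n}$ is the outward unit normal to $\partial W$. The function $\theta=\arg$ is multi-valued, but $D\theta(x)=x^\perp/|x|^2$ with $(x_1,x_2)^\perp=(-x_2,x_1)$ is single-valued and smooth on $\overline W$; only $D\theta$ and $D^2\theta$ enter the equation, and $D(u-\theta)$ means $Du-D\theta$. Viscosity solutions are understood in the standard sense for level-set mean curvature type equations (semicontinuous envelopes of the operator where $Du-D\theta=0$, Neumann condition in the viscosity sense); it is known that the comparison principle holds, that there is a unique viscosity solution $u\in C(\overline W\times[0,\infty))$, and that the limit defining $S_c$ exists. *)

(* Defs.v *)
From mathcomp Require Import all_boot all_order all_algebra.
From mathcomp Require Import all_classical all_reals all_analysis.
Set Implicit Arguments.
Unset Strict Implicit.
Unset Printing Implicit Defensive.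
Import Order.TTheory GRing.Theory Num.Theory.
Import numFieldNormedType.Exports.
Local Open Scope classical_set_scope.
Local Open Scope ring_scope.

Section Plane.
Variable R : realType.
Implicit Types (p q x : 'rV[R]_2) (X : 'M[R]_2).

Definition dot p q : R := \sum_(i < 2) p 0 i * q 0 i.

(* The library norm `|p| on 'rV_2 is the sup norm, hence this definition. *)
Definition enorm p : R := Num.sqrt (dot p p).

Definition perp p : 'rV[R]_2 :=
  \row_(i < 2) (if i == 0 then - p 0 1 else p 0 0).

Definition basis (i : 'I_2) : 'rV[R]_2 := delta_mx 0 i.

Definition annulus (r1 r2 : R) : set 'rV[R]_2 :=
  [set x | r1 < enorm x < r2].

(* Outward unit normal; only meaningful where enorm x is r1 or r2. *)
Definition annulus_normal (r1 r2 : R) x : 'rV[R]_2 :=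
  if enorm x == r2 then r2^-1 *: x else - (r1^-1 *: x).

(* The argument theta is multivalued, so only its derivatives are defined. *)
Definition Dtheta x : 'rV[R]_2 := (enorm x ^+ 2)^-1 *: perp x.

Definition D2theta x : 'M[R]_2 :=
  \matrix_(i < 2, j < 2) 'D_(basis j) (fun y => Dtheta y 0 i) x.

(* f is in C^1 of the closure of the open set W, resp. C^2: the derivatives
   taken in W extend continuously to the closure. The extensions (unique there)
   are the arguments Df and D2f. *)
Definition C1_closure (W : set 'rV[R]_2) (f : 'rV[R]_2 -> R)
    (Df : 'rV[R]_2 -> 'rV[R]_2) : Prop :=
  [/\ {within closure W, continuous f},
      {within closure W, continuous Df} &
      forall x i, W x -> is_derive x (basis i) f (Df x 0 i)].

Definition C2_closure (W : set 'rV[R]_2) (f : 'rV[R]_2 -> R)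
    (Df : 'rV[R]_2 -> 'rV[R]_2) (D2f : 'rV[R]_2 -> 'M[R]_2) : Prop :=
  [/\ C1_closure W f Df,
      {within closure W, continuous D2f} &
      forall x i j, W x ->
        is_derive x (basis j) (fun y => Df y 0 i) (D2f x i j)].

Definition cylinder (W : set 'rV[R]_2) : set ('rV[R]_2 * R) :=
  closure W `*` [set t : R | 0 < t].

(* phi is C^2 in x and C^1 in t on cylinder W, in the sense of C2_closure. *)
Definition C21_cylinder (W : set 'rV[R]_2) (phi phit : 'rV[R]_2 -> R -> R)
    (Dphi : 'rV[R]_2 -> R -> 'rV[R]_2) (D2phi : 'rV[R]_2 -> R -> 'M[R]_2) :
    Prop :=
  [/\ {within cylinder W, continuous (fun z => phi z.1 z.2)},
      {within cylinder W, continuous (fun z => phit z.1 z.2)},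
      {within cylinder W, continuous (fun z => Dphi z.1 z.2)} &
      {within cylinder W, continuous (fun z => D2phi z.1 z.2)}] /\
  forall x (t : R), W x -> 0 < t ->
    [/\ is_derive t (1 : R) (phi x) (phit x t),
        forall i, is_derive x (basis i) (phi^~ t) (Dphi x t 0 i) &
        forall i j, is_derive x (basis j) (fun y => Dphi y t 0 i)
                      (D2phi x t i j)].

(* For p = Dv(x) != 0 and X = D^2 v(x) this is |Dv| (div (Dv / |Dv|) + c),
   by expanding the divergence. *)
Definition mcf_op (c : 'rV[R]_2 -> R) x p X : R :=
  \tr ((1%:M - (enorm p ^+ 2)^-1 *: (p^T *m p)) *m X) + c x * enorm p.

(* Points (y, q, Y) near (x, p, X) at which the operator is defined. *)
Definition mcf_dom (W : set 'rV[R]_2) :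
    set ('rV[R]_2 * 'rV[R]_2 * 'M[R]_2) :=
  [set z | [/\ closure W z.1.1, z.1.2 != 0 & z.2^T = z.2]].

(* Semicontinuous envelopes. The operator is continuous where p != 0, so it
   coincides there with both of its envelopes. *)
Definition mcf_upper (W : set 'rV[R]_2) (c : 'rV[R]_2 -> R) x p X : \bar R :=
  if p == 0 then
    limf_esup (fun z => (mcf_op c z.1.1 z.1.2 z.2)%:E)
      (within (mcf_dom W) (nbhs (x, p, X)))
  else (mcf_op c x p X)%:E.

Definition mcf_lower (W : set 'rV[R]_2) (c : 'rV[R]_2 -> R) x p X : \bar R :=
  if p == 0 then
    limf_einf (fun z => (mcf_op c z.1.1 z.1.2 z.2)%:E)
      (within (mcf_dom W) (nbhs (x, p, X)))
  else (mcf_op c x p X)%:E.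

Definition local_max_on (A : set ('rV[R]_2 * R)) (f : 'rV[R]_2 -> R -> R) x
    (t : R) : Prop :=
  \forall z \near within A (nbhs (x, t)), f z.1 z.2 <= f x t.

Definition local_min_on (A : set ('rV[R]_2 * R)) (f : 'rV[R]_2 -> R -> R) x
    (t : R) : Prop :=
  \forall z \near within A (nbhs (x, t)), f x t <= f z.1 z.2.

Definition spiral_subsolution (W : set 'rV[R]_2) (n : 'rV[R]_2 -> 'rV[R]_2)
    (c : 'rV[R]_2 -> R) (u : 'rV[R]_2 -> R -> R) : Prop :=
  forall phi phit Dphi D2phi, C21_cylinder W phi phit Dphi D2phi ->
  forall x t, cylinder W (x, t) ->
    local_max_on (cylinder W) (fun y s => u y s - phi y s) x t ->
    let p := Dphi x t - Dtheta x in
    let X := D2phi x t - D2theta x in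
    ((phit x t)%:E <= mcf_upper W c x p X)%E \/ (~ W x /\ dot p (n x) <= 0).

Definition spiral_supersolution (W : set 'rV[R]_2) (n : 'rV[R]_2 -> 'rV[R]_2)
    (c : 'rV[R]_2 -> R) (u : 'rV[R]_2 -> R -> R) : Prop :=
  forall phi phit Dphi D2phi, C21_cylinder W phi phit Dphi D2phi ->
  forall x t, cylinder W (x, t) ->
    local_min_on (cylinder W) (fun y s => u y s - phi y s) x t ->
    let p := Dphi x t - Dtheta x in
    let X := D2phi x t - D2theta x in
    (mcf_lower W c x p X <= (phit x t)%:E)%E \/ (~ W x /\ 0 <= dot p (n x)).

(* Continuous viscosity solution of the initial-boundary value problem; the
   values of u outside closure W x [0, +oo[ play no role. *)
Definition spiral_solution (W : set 'rV[R]_2) (n : 'rV[R]_2 -> 'rV[R]_2)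
    (c u0 : 'rV[R]_2 -> R) (u : 'rV[R]_2 -> R -> R) : Prop :=
  [/\ {within closure W `*` [set t : R | 0 <= t],
        continuous (fun z : 'rV[R]_2 * R => u z.1 z.2)},
      spiral_subsolution W n c u,
      spiral_supersolution W n c u &
      forall x, closure W x -> u x 0 = u0 x].

(* Used only for continuous f on a nonempty compact A, where the supremum and
   the infimum are attained. *)
Definition max_on (A : set 'rV[R]_2) (f : 'rV[R]_2 -> R) : R := sup (f @` A).
Definition min_on (A : set 'rV[R]_2) (f : 'rV[R]_2 -> R) : R := inf (f @` A).

End Plane.

(* Main.v *)
(** Since Dtheta / |Dtheta| is divergence free and |Dtheta| = 1/|x|, the operator
    sends functions of t alone to c(x)/|x|, so (max c/|x|) t and (min c/|x|) t
    are a super- and a subsolution with zero Neumann data. To apply the viscosity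
    inequalities they are perturbed by s g(x) with g = (|x|^2 - b)^2,
    b = (r1^2 + r2^2)/2: Dg.n > 0 on both boundary circles, which excludes the
    Neumann alternative for s of the right sign, and the operator changes only by
    O(s). The gradient stays nonzero because Dg is radial and Dtheta tangential,
    so neither the envelopes nor doubling of variables enter. *)

Require Import Defs.
From mathcomp Require Import all_boot all_order all_algebra.
From mathcomp Require Import all_classical all_reals all_analysis.
From mathcomp Require Import ring lra.
Set Implicit Arguments.
Unset Strict Implicit.
Unset Printing Implicit Defensive.
Import Order.TTheory GRing.Theory Num.Theory.
Import numFieldNormedType.Exports.
Local Open Scope classical_set_scope.
Local Open Scope ring_scope.

(** * Plane coordinates and the derivative of [Dtheta] *)

Section PlaneCalculus.
Variable R : realType.
Implicit Types (p q x v : 'rV[R]_2) (X : 'M[R]_2) (b s : R).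
Local Notation basis := (@Defs.basis R).

Lemma scale_mulE (a b : R) : a *: b = a * b.
Proof. by []. Qed.

Lemma ord2P (i : 'I_2) : i = 0 \/ i = 1.
Proof. by case: i => [[|[]]] // k; [left|right]; apply/val_inj. Qed.

Lemma sum_ord2 (F : 'I_2 -> R) : \sum_(i < 2) F i = F 0 + F 1.
Proof. by rewrite big_ord_recl big_ord1; congr (_ + F _); apply/val_inj. Qed.

Lemma dotE p q : dot p q = p 0 0 * q 0 0 + p 0 1 * q 0 1.
Proof. exact: sum_ord2. Qed.

Lemma dot_ge0 p : 0 <= dot p p.
Proof. by rewrite dotE addr_ge0 // -expr2 sqr_ge0. Qed.

Lemma sqr_enorm p : enorm p ^+ 2 = dot p p.
Proof. by rewrite sqr_sqrtr // dot_ge0. Qed.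

Lemma is_derive_coord x v (i : 'I_2) : is_derive x v (fun y => y 0 i) (v 0 i).
Proof.
have h : derivable (@id 'rV[R]_2) x v by exact: derivable_id.
apply: DeriveDef; first by have /derivable_mxP/(_ 0 i) := h.
by have := derive_mx h; rewrite derive_id => {2}->; rewrite mxE.
Qed.

Lemma is_derive_dot_self x v : is_derive x v (fun y => dot y y) (2 * dot x v).
Proof.
have -> : (fun y => dot y y) =
    (fun y : 'rV[R]_2 => y 0 0) * (fun y : 'rV[R]_2 => y 0 0) +
    (fun y : 'rV[R]_2 => y 0 1) * (fun y : 'rV[R]_2 => y 0 1).
  by apply/funext => y; rewrite dotE.
have d0 := is_derive_coord x v 0; have d1 := is_derive_coord x v 1.
apply: is_derive_eq (is_deriveD (is_deriveM d0 d0) (is_deriveM d1 d1)) _.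
rewrite !scale_mulE dotE; ring.
Qed.

Lemma is_derive_inv (f : 'rV[R]_2 -> R) x v (df : R) : f x != 0 ->
  is_derive x v f df -> is_derive x v (fun y => (f y)^-1) (- (f x) ^- 2 * df).
Proof.
move=> fx0 dfx; have fd : derivable f x v by [].
apply: DeriveDef; first exact: derivableV fx0 fd.
by have := deriveV fx0 fd; rewrite (@derive_val _ _ _ _ _ _ _ dfx).
Qed.

Lemma basisE (i j : 'I_2) : (basis i) 0 j = (j == i)%:R.
Proof. by rewrite /basis mxE eqxx. Qed.

Lemma dot_basis x (i : 'I_2) : dot x (basis i) = x 0 i.
Proof.
rewrite /dot (bigD1 i) //= basisE eqxx mulr1 big1 ?addr0 // => j ji.
by rewrite basisE (negbTE ji) mulr0.
Qed.

Lemma perpE x : (perp x 0 0 = - x 0 1) * (perp x 0 1 = x 0 0).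
Proof. by rewrite /perp !mxE. Qed.

Lemma derive_Dtheta x v (i : 'I_2) : dot x x != 0 ->
  'D_v (fun y => Dtheta y 0 i) x =
  (dot x x)^-1 * perp v 0 i - 2 * dot x v * (dot x x ^-2) * perp x 0 i.
Proof.
move=> x0.
have -> : (fun y => Dtheta y 0 i) =
    (fun y : 'rV[R]_2 => (dot y y)^-1) * (fun y : 'rV[R]_2 => perp y 0 i).
  by apply/funext => y; rewrite /Dtheta mxE sqr_enorm.
have dN := is_derive_dot_self x v.
have dp : is_derive x v (fun y : 'rV[R]_2 => perp y 0 i) (perp v 0 i).
  have [->|->] := ord2P i.
  - under eq_fun do rewrite perpE; rewrite perpE.
    by apply: is_deriveN; exact: is_derive_coord.
  - under eq_fun do rewrite perpE; rewrite perpE.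
    exact: is_derive_coord.
have dV := @is_derive_inv (fun y => dot y y) _ _ _ x0 dN.
apply: (@derive_val).
apply: is_derive_eq (is_deriveM dV dp) _.
rewrite !scale_mulE; ring.
Qed.

(** * Derivatives of the barrier g, whose gradient is [radial b x] times x *)

Definition radial b x : R := 4 * (dot x x - b).

Definition barrier b x : R := (dot x x - b) ^+ 2.

Definition Dbarrier b x : 'rV[R]_2 := radial b x *: x.

Definition D2barrier b x : 'M[R]_2 := 8 *: (x^T *m x) + (radial b x)%:M.

Lemma D2barrierE b x (i j : 'I_2) :
  D2barrier b x i j = 8 * (x 0 i * x 0 j) + radial b x * (i == j)%:R.
Proof. by rewrite /D2barrier !mxE big_ord1 !mxE mulr_natr. Qed.

Lemma is_derive_radial b x v : is_derive x v (radial b) (8 * dot x v).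
Proof.
have -> : radial b = 4 \*: ((fun y => dot y y) - cst b).
  by apply/funext => y.
have dN := is_derive_dot_self x v.
apply: is_derive_eq; rewrite !scale_mulE; ring.
Qed.

Lemma is_derive_barrier b x (i : 'I_2) :
  is_derive x (basis i) (barrier b) (Dbarrier b x 0 i).
Proof.
have -> : barrier b = ((fun y => dot y y) - cst b) ^+ 2.
  by apply/funext => y.
have dN := is_derive_dot_self x (basis i).
apply: is_derive_eq.
rewrite dot_basis /Dbarrier /radial mxE !scale_mulE /= !fctE; ring.
Qed.

Lemma is_derive_Dbarrier b x (i j : 'I_2) :
  is_derive x (basis j) (fun y => Dbarrier b y 0 i) (D2barrier b x i j).
Proof.
have -> : (fun y => Dbarrier b y 0 i) = radial b * (fun y => y 0 i).
  by apply/funext => y; rewrite /Dbarrier mxE.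
have dr := is_derive_radial b x (basis j).
have dc := is_derive_coord x (basis j) i.
apply: is_derive_eq.
rewrite dot_basis basisE D2barrierE !scale_mulE.
ring.
Qed.

(** * Continuity of the barrier and regularity of the test functions *)

Lemma continuous_const (T : topologicalType) (a : R) : continuous (fun _ : T => a).
Proof. by move=> x; exact: cvg_cst. Qed.

Lemma continuous_add (T : topologicalType) (f g : T -> R) :
  continuous f -> continuous g -> continuous (fun z => f z + g z).
Proof. by move=> cf cg x; exact: cvgD (cf x) (cg x). Qed.

Lemma continuous_mul (T : topologicalType) (f g : T -> R) :
  continuous f -> continuous g -> continuous (fun z => f z * g z).
Proof. by move=> cf cg x; exact: cvgM (cf x) (cg x). Qed.

Lemma continuous_matrix (T : topologicalType) (m n : nat)
    (f : T -> 'M[R]_(m, n)) :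
  (forall i j, continuous (fun z => f z i j)) -> continuous f.
Proof.
move=> h z A [P MP PA]; apply: filterS => [y|]; first by apply: PA.
apply: filter_forall => i; apply: filter_forall => j.
exact: h (MP i j).
Qed.

Lemma continuous_scale_matrix (T : topologicalType) (m n : nat) (s : R)
    (f : T -> 'M[R]_(m, n)) : continuous f -> continuous (fun z => s *: f z).
Proof.
move=> cf; apply: continuous_matrix => i j.
under eq_fun do rewrite mxE.
have cfij : continuous (fun z => f z i j).
  move=> z; apply: (@continuous_comp _ _ _ f (fun M : 'M[R]_(m, n) => M i j)).
    exact: cf.
  exact: coord_continuous.
exact: (continuous_mul (@continuous_const _ s) cfij).
Qed.

Lemma continuous_comp_fst (S T U : topologicalType) (f : S -> U) :
  continuous f -> continuous (fun z : S * T => f z.1).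
Proof. by move=> cf z; apply: continuous_comp; [exact: cvg_fst|exact: cf]. Qed.

Lemma continuous_comp_snd (S T U : topologicalType) (f : T -> U) :
  continuous f -> continuous (fun z : S * T => f z.2).
Proof. by move=> cf z; apply: continuous_comp; [exact: cvg_snd|exact: cf]. Qed.

Lemma continuous_dot_self : continuous (fun y : 'rV[R]_2 => dot y y).
Proof.
have h i : continuous (fun y : 'rV[R]_2 => y 0 i) by exact: coord_continuous.
under eq_fun do rewrite dotE.
exact: (continuous_add (continuous_mul (h 0) (h 0)) (continuous_mul (h 1) (h 1))).
Qed.

Lemma continuous_dot_subr b : continuous (fun y : 'rV[R]_2 => dot y y - b).
Proof.
exact: (continuous_add continuous_dot_self (@continuous_const _ (- b))).
Qed.

Lemma continuous_radial b : continuous (radial b).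
Proof.
exact: (continuous_mul (@continuous_const _ 4) (@continuous_dot_subr b)).
Qed.

Lemma continuous_barrier b : continuous (barrier b).
Proof.
exact: (continuous_mul (@continuous_dot_subr b) (@continuous_dot_subr b)).
Qed.

Lemma continuous_Dbarrier b : continuous (Dbarrier b).
Proof.
apply: continuous_matrix => i j.
have -> : (fun y => Dbarrier b y i j) = (fun y => radial b y * y i j).
  by apply/funext => y; rewrite mxE.
exact: (continuous_mul (@continuous_radial b) (@coord_continuous _ _ _ i j)).
Qed.

Lemma continuous_D2barrier b : continuous (D2barrier b).
Proof.
apply: continuous_matrix => i j.
have h k : continuous (fun y : 'rV[R]_2 => y 0 k) by exact: coord_continuous.
have -> : (fun y => D2barrier b y i j) =
    (fun y => 8 * (y 0 i * y 0 j) + radial b y * (i == j)%:R).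
  by apply/funext => y; rewrite D2barrierE.
exact: (continuous_add
  (continuous_mul (@continuous_const _ 8) (continuous_mul (h i) (h j)))
  (continuous_mul (@continuous_radial b) (@continuous_const _ _))).
Qed.

(** These are the test functions of the whole proof: time and space are separated, so each
    derivative acts on a single summand. *)
Lemma C21_barrier (W : set 'rV[R]_2) b s (H H' : R -> R) :
  (forall t, is_derive t (1 : R) H (H' t)) -> continuous H' ->
  C21_cylinder W (fun x t => H t + s * barrier b x) (fun _ t => H' t)
    (fun x _ => s *: Dbarrier b x) (fun x _ => s *: D2barrier b x).
Proof.
move=> dH cH'.
have cH : continuous H.
  by move=> t; apply/differentiable_continuous/derivable1_diffP; case: (dH t).
split.
  split; apply: continuous_subspaceT.
  - exact: (continuous_add (continuous_comp_snd cH)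
      (continuous_mul (@continuous_const _ s)
        (continuous_comp_fst (@continuous_barrier b)))).
  - exact: continuous_comp_snd cH'.
  - have h := @continuous_scale_matrix _ _ _ s _ (@continuous_Dbarrier b).
    exact: (continuous_comp_fst h).
  - have h := @continuous_scale_matrix _ _ _ s _ (@continuous_D2barrier b).
    exact: (continuous_comp_fst h).
move=> x t _ _; split.
- apply: is_derive_eq (is_deriveD (dH t) (is_derive_cst (s * barrier b x) _ _)) _.
  by rewrite addr0.
- move=> i; have dg := is_deriveZ s (is_derive_barrier b x i).
  apply: is_derive_eq (is_deriveD (is_derive_cst (H t) _ _) dg) _.
  by rewrite add0r [RHS]mxE.
- move=> i j; have dg := is_deriveZ s (is_derive_Dbarrier b x i j).
  have -> : (fun y => (s *: Dbarrier b y) 0 i) = s \*: (fun y => Dbarrier b y 0 i).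
    by apply/funext => y; rewrite mxE.
  by apply: is_derive_eq dg _; rewrite [RHS]mxE.
Qed.

End PlaneCalculus.

(** * The operator evaluated on the barrier *)

Section BarrierOperator.
Variable R : realType.
Implicit Types (p q x v : 'rV[R]_2) (X : 'M[R]_2) (b s : R).
Local Notation basis := (@Defs.basis R).

(** In the plane, I - p^T p / |p|^2 is the projection onto the line of p^perp, so the trace is
    X(p^perp, p^perp) / |p|^2. *)
Lemma mcf_opE (c : 'rV[R]_2 -> R) x p X : dot p p != 0 ->
  mcf_op c x p X =
  (p 0 1 ^+ 2 * X 0 0 - p 0 0 * p 0 1 * (X 0 1 + X 1 0) + p 0 0 ^+ 2 * X 1 1)
    / dot p p + c x * enorm p.
Proof.
move=> p0; rewrite /mcf_op sqr_enorm; congr (_ + _).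
rewrite /mxtrace sum_ord2 !mxE !sum_ord2 !mxE !big_ord1 !mxE /=.
by move: p0; rewrite dotE => p0; field; exact: p0.
Qed.

Section Operator.
Variables (b s : R) (x : 'rV[R]_2).
Hypothesis x0 : dot x x != 0.
Let p := s *: Dbarrier b x - Dtheta x.
Let X := s *: D2barrier b x - D2theta x.

Let pE : (p 0 0 = s * radial b x * x 0 0 + x 0 1 / dot x x) *
         (p 0 1 = s * radial b x * x 0 1 - x 0 0 / dot x x).
Proof.
rewrite /p /Dbarrier /Dtheta sqr_enorm; split;
  rewrite !mxE /= ?eqxx; field; exact: x0.
Qed.

Let XE (i j : 'I_2) : X i j =
  s * (8 * (x 0 i * x 0 j) + radial b x * (i == j)%:R) -
  ((dot x x)^-1 * perp (basis j) 0 i - 2 * x 0 j * (dot x x ^-2) * perp x 0 i).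
Proof.
have -> : X i j = s * D2barrier b x i j - D2theta x i j.
  by rewrite [LHS]mxE [t in t + _]mxE [t in _ + t]mxE.
by rewrite D2barrierE [D2theta x i j]mxE derive_Dtheta // dot_basis.
Qed.

(** Pythagoras: the barrier part of p is radial, hence orthogonal to [Dtheta x], whose squared
    length is 1 / |x|^2. *)
Lemma barrier_slopeE :
  dot p p = (s * radial b x) ^+ 2 * dot x x + (dot x x)^-1.
Proof.
rewrite [LHS]dotE !pE; move: x0; rewrite dotE => n0.
by field; exact: n0.
Qed.

Lemma barrier_slope_gt0 : 0 < dot p p.
Proof.
have N0 : 0 < dot x x by rewrite lt0r x0 dot_ge0.
by rewrite barrier_slopeE ltr_wpDl ?invr_gt0 // mulr_ge0 ?sqr_ge0 // ltW.
Qed.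

(* The curvature term is X(p^perp, p^perp) / |p|^2. With k = radial b x,
   p^perp = s k x^perp + x / |x|^2 and p^perp . x = 1, the first two terms
   come from D^2 g = 8 x (x) x + k I and the last one from D^2 theta. *)
Lemma mcf_op_barrier (c : 'rV[R]_2 -> R) :
  mcf_op c x p X = 8 * s / dot p p + s * radial b x
    + 2 * s * radial b x / (dot x x * dot p p) + c x * enorm p.
Proof.
have q0 := lt0r_neq0 barrier_slope_gt0.
rewrite mcf_opE //; congr (_ + _).
(* Multiplying by |p|^2 clears it from the denominators, after which its closed form can be
   substituted. *)
apply: (mulIf q0); rewrite [LHS]mulfVK // [RHS]mulrDl [t in _ = t + _]mulrDl.
rewrite [t in _ = t + _ + _]mulfVK //.
have -> : 2 * s * radial b x / (dot x x * dot p p) * dot p p =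
          2 * s * radial b x / dot x x.
  by field; apply/andP.
rewrite barrier_slopeE !pE !XE !perpE !basisE /=.
(* What remains is a rational identity in s, the coordinates and k, valid for arbitrary k. *)
move: (radial b x) x0 => k; rewrite !dotE => n0.
by field; exact: n0.
Qed.

End Operator.
End BarrierOperator.

(** * The closed annulus: compactness, boundary sign and operator bounds *)

Section BarrierBounds.
Variable R : realType.
Variables (r1 r2 : R).
Hypotheses (hr1 : 0 < r1) (hr12 : r1 < r2).
Implicit Types (x : 'rV[R]_2) (s : R).

Lemma continuous_enorm : continuous (@enorm R).
Proof.
move=> x; apply: (@continuous_comp _ _ _ (fun y => dot y y) Num.sqrt).
  exact: continuous_dot_self.
exact: sqrt_continuous.
Qed.

Lemma closure_annulus_sub x : closure (annulus r1 r2) x -> r1 <= enorm x <= r2.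
Proof.
have cl : closed [set x : 'rV[R]_2 | r1 <= enorm x <= r2].
  have -> : [set x | r1 <= enorm x <= r2] = @enorm R @^-1` `[r1, r2].
    by apply/seteqP; split => y; rewrite /= in_itv.
  by apply: preimage_closed; [move=> y _; exact: continuous_enorm|exact: interval_closed].
move=> xW; apply: cl; apply: closure_subset xW => y /andP[a b].
by rewrite /= !ltW.
Qed.

Lemma closure_annulus_compact : compact (closure (annulus r1 r2)).
Proof.
have K := @rV_compact R 2 (fun _ => `[- r2, r2]%classic) (fun _ => @segment_compact _ _ _).
apply: (subclosed_compact _ K); first exact: closed_closure.
move=> x /closure_annulus_sub /andP[_ xr] i /=.
rewrite in_itv /= -ler_norml; apply: le_trans xr.
rewrite -sqrtr_sqr /enorm ler_wsqrtr // dotE.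
have [->|->] := ord2P i.
- by rewrite expr2 lerDl -expr2 sqr_ge0.
- by rewrite expr2 lerDr -expr2 sqr_ge0.
Qed.

Lemma annulus_nonempty : closure (annulus r1 r2) !=set0.
Proof.
exists (\row_(i < 2) (if i == 0 then (r1 + r2) / 2 else 0)).
apply: subset_closure; rewrite /annulus /= /enorm dotE !mxE /= mul0r addr0 -expr2.
have [h1 h2] := (hr1, hr12).
rewrite sqrtr_sqr ger0_norm; first by apply/andP; split; lra.
by lra.
Qed.

Let b := (r1 ^+ 2 + r2 ^+ 2) / 2.

Let sqr_lt : r1 ^+ 2 < r2 ^+ 2.
Proof. by rewrite ltr_sqr ?nnegrE // ltW // (lt_trans hr1). Qed.

(** Only the radial part meets the normal, as [Dtheta] is tangential. Since r1^2 < b < r2^2, the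
    factor [radial b x] is positive on the outer circle and negative on the inner one, just as the
    outward normal is a positive or negative multiple of x. *)
Lemma dot_barrier_normal x : closure (annulus r1 r2) x -> ~ annulus r1 r2 x ->
  exists2 k, 0 < k & forall s,
    dot (s *: Dbarrier b x - Dtheta x) (annulus_normal r1 r2 x) = s * k.
Proof.
move=> /closure_annulus_sub/andP[x1 x2] nx.
have x0 : dot x x != 0.
  by rewrite -sqr_enorm expf_neq0 // gt_eqF // (lt_le_trans hr1).
have E s a : dot (s *: Dbarrier b x - Dtheta x) (a *: x) =
    s * (a * radial b x * dot x x).
  rewrite /Dbarrier /Dtheta sqr_enorm dotE !mxE /=; move: x0.
  by move: (radial b x) => k; rewrite dotE => x0; field; exact: x0.
have N0 : 0 < dot x x by rewrite lt0r x0 dot_ge0.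
have r2p : 0 < r2 by exact: lt_trans hr12.
rewrite /annulus_normal; case: eqVneq => xr2.
  exists (r2^-1 * radial b x * dot x x) => //.
  rewrite !mulr_gt0 ?invr_gt0 // /radial -sqr_enorm xr2 /b.
  by have := sqr_lt; lra.
have xr1 : enorm x = r1.
  apply/eqP; rewrite eq_le x1 andbT leNgt; apply/negP => h.
  by apply: nx; rewrite /annulus /= h lt_neqAle xr2 x2.
exists (- r1^-1 * radial b x * dot x x); last by move=> s; rewrite -E scaleNr.
rewrite -mulrA mulNr -mulrN mulr_gt0 ?invr_gt0 // -mulNr mulr_gt0 //.
by rewrite /radial -sqr_enorm xr1 /b; have := sqr_lt; lra.
Qed.

Lemma radial_bound x : closure (annulus r1 r2) x -> `|radial b x| <= 4 * r2 ^+ 2.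
Proof.
move=> /closure_annulus_sub/andP[x1 x2]; rewrite /radial -sqr_enorm ler_norml /b.
have r2p : 0 < r2 by exact: lt_trans hr12.
have t1 : r1 ^+ 2 <= enorm x ^+ 2.
  by rewrite ler_sqr ?nnegrE ?sqrtr_ge0 ?(ltW hr1) ?(ltW r2p).
have t2 : enorm x ^+ 2 <= r2 ^+ 2.
  by rewrite ler_sqr ?nnegrE ?sqrtr_ge0 ?(ltW hr1) ?(ltW r2p).
have h0 := sqr_ge0 r1; have h1 := sqr_lt.
by apply/andP; split; lra.
Qed.

Lemma barrier_slope_neq0 s x : closure (annulus r1 r2) x ->
  s *: Dbarrier b x - Dtheta x != 0.
Proof.
move=> /closure_annulus_sub/andP[x1 _].
have x0 : dot x x != 0.
  by rewrite -sqr_enorm expf_neq0 // gt_eqF // (lt_le_trans hr1).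
apply: contraTneq (barrier_slope_gt0 b s x0) => ->.
by rewrite dotE !mxE !mul0r addr0 ltxx.
Qed.

(** At s = 0 the operator equals c / |x|, and the curvature term is s times a bounded factor. The
    lower bound carries no error from c because |p| >= |Dtheta| = 1 / |x|; the upper one pays for
    the excess of |p| over 1 / |x|. *)
Lemma mcf_op_barrier_bounds (c : 'rV[R]_2 -> R) s x :
  closure (annulus r1 r2) x -> 0 <= c x ->
  c x / enorm x - `|s| * (20 * r2 ^+ 2) <=
    mcf_op c x (s *: Dbarrier b x - Dtheta x) (s *: D2barrier b x - D2theta x) <=
  c x / enorm x + `|s| * (20 * r2 ^+ 2 + c x / enorm x * (4 * r2 ^+ 4)).
Proof.
move=> xW cx; have := radial_bound xW.
have /andP[x1 x2] := closure_annulus_sub xW.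
have t0 : 0 < enorm x by exact: lt_le_trans x1.
have x0 : dot x x != 0 by rewrite -sqr_enorm expf_neq0 // gt_eqF.
have Q0 := barrier_slope_gt0 b s x0; have QE := barrier_slopeE b s x0.
rewrite mcf_op_barrier // [enorm (_ - _)]/enorm.
move: Q0 QE; set Q := dot _ _; rewrite -sqr_enorm.
move: (enorm x) t0 x1 x2 => t t0 x1 x2 Q0 QE.
move: (radial b x) QE => k QE kr.
(* Here t = |x| and Q = |p|^2. Thus t^2 Q >= 1 for every s, which bounds 1/Q and 1/(t^2 Q) uniformly
   in s. *)
have QtE : Q * t ^+ 2 = (s * k * t ^+ 2) ^+ 2 + 1.
  by rewrite QE; field; rewrite gt_eqF.
have Qinv : Q^-1 <= t ^+ 2.
  rewrite -div1r ler_pdivrMr // mulrC QtE lerDr sqr_ge0 //.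
have Qtinv : (t ^+ 2 * Q)^-1 <= 1.
  rewrite invf_le1 ?mulr_gt0 ?exprn_gt0 // mulrC QtE lerDr sqr_ge0 //.
have sQ1 : t^-1 <= Num.sqrt Q.
  rewrite -(@ger0_norm _ t^-1) ?invr_ge0 ?(ltW t0) // -sqrtr_sqr ler_wsqrtr // QE.
  by rewrite exprVn lerDr mulr_ge0 ?sqr_ge0.
(* Triangle inequality |p| <= |Dtheta| + |s Dg|, checked by comparing squares. *)
have sQ2 : Num.sqrt Q <= t^-1 + `|s| * `|k| * t.
  have h : 0 <= t^-1 + `|s| * `|k| * t.
    by rewrite addr_ge0 ?invr_ge0 ?(ltW t0) // !mulr_ge0 // ltW.
  rewrite -[leRHS](ger0_norm h) -[leRHS]sqrtr_sqr ler_wsqrtr // QE.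
  rewrite -normrM sqrrD exprVn [(`|_| * t) ^+ 2]exprMn real_normK ?num_real //.
  by rewrite [leRHS]addrC addrA lerDl mulrn_wge0 // !mulr_ge0 ?invr_ge0 // ltW.
(* 20 = 8 + 4 + 8: the three terms use 1/Q <= t^2 <= r2^2, then |k| <= 4 r2^2, then both |k| <= 4
   r2^2 and 1/(t^2 Q) <= 1. *)
have curv : `|8 * s / Q + s * k + 2 * s * k / (t ^+ 2 * Q)| <= `|s| * (20 * r2 ^+ 2).
  have -> : 8 * s / Q + s * k + 2 * s * k / (t ^+ 2 * Q) =
      s * (8 * Q^-1 + k + 2 * k * (t ^+ 2 * Q)^-1).
    by field; rewrite !gt_eqF.
  rewrite normrM ler_wpM2l //.
  have Qi0 : 0 < Q^-1 by rewrite invr_gt0.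
  have Qt0 : 0 < (t ^+ 2 * Q)^-1 by rewrite invr_gt0 mulr_gt0 ?exprn_gt0.
  have t2 : t ^+ 2 <= r2 ^+ 2 by nra.
  move: kr; rewrite !ler_norml => /andP[k1 k2].
  move: (Q^-1) ((t ^+ 2 * Q)^-1) Qinv Qtinv Qi0 Qt0 => q w Qinv Qtinv Qi0 Qt0.
  have m0 := mulr_ge0 (ltW Qt0) (ltac:(lra) : 0 <= 4 * r2 ^+ 2 - k).
  have m1 := mulr_ge0 (ltW Qt0) (ltac:(lra) : 0 <= 4 * r2 ^+ 2 + k).
  have m2 := mulr_ge0 (sqr_ge0 r2) (ltac:(lra) : 0 <= 1 - w).
  by apply/andP; split; lra.
move: curv; rewrite ler_norml => /andP[curv1 curv2].
have cQ1 : c x / t <= c x * Num.sqrt Q by rewrite ler_wpM2l.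
have cQ2 : c x * Num.sqrt Q <= c x / t + `|s| * (c x / t * (4 * r2 ^+ 4)).
  apply: (le_trans (ler_wpM2l cx sQ2)); rewrite mulrDr lerD2l.
  have -> : c x * (`|s| * `|k| * t) = `|s| * (c x / t * (`|k| * t ^+ 2)).
    by field; rewrite gt_eqF.
  rewrite ler_wpM2l // ler_wpM2l ?divr_ge0 ?(ltW t0) //.
  have -> : 4 * r2 ^+ 4 = (4 * r2 ^+ 2) * r2 ^+ 2 by ring.
  by rewrite ler_pM ?sqr_ge0 // ler_sqr ?nnegrE // ltW // (lt_le_trans t0).
apply/andP; split; first by rewrite addrC lerD.
by rewrite addrC mulrDr [leRHS]addrA [leRHS]addrAC lerD.
Qed.

End BarrierBounds.

(** * A maximum principle on an unbounded time interval *)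

Section MaximumPrinciple.
Variable R : realType.

(** If f exceeded its initial maximum, subtracting a suitable penalty h(t) would create a local
    maximum at a positive time, two-sided in time. The premise excludes this, and strict barriers
    supply the premise: a slope h' >= 0 only strengthens their strict inequality. *)
Lemma bounded_of_no_interior_max (X : topologicalType) (K : set X)
    (f : X -> R -> R) :
  compact K ->
  {within K `*` [set t : R | 0 <= t], continuous (fun z : X * R => f z.1 z.2)} ->
  (forall (h h' : R -> R) x t, (forall s, is_derive s (1 : R) h (h' s)) ->
     continuous h' -> 0 <= h' t -> K x -> 0 < t ->
     (\forall z \near within (K `*` [set t : R | 0 < t]) (nbhs (x, t)),
        f z.1 z.2 - h z.2 <= f x t - h t) -> False) ->
  exists M, forall x t, K x -> 0 <= t -> f x t <= M.
Proof.
move=> cK cf nomax.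
have [->|/set0P K0] := eqVneq K set0; first by exists 0.
(* Applied three times: to f at the initial time (T = 0), to f up to t + 1, and to f - h up to t +
   1. *)
have attained (g : X -> R -> R) T : 0 <= T ->
    {within K `*` [set t : R | 0 <= t], continuous (fun z : X * R => g z.1 z.2)} ->
    exists y s, [/\ K y, 0 <= s <= T &
      forall x t, K x -> 0 <= t <= T -> g x t <= g y s].
  move=> T0 cg.
  have cKT : compact (K `*` `[0, T]%classic) := compact_setX cK (@segment_compact _ _ _).
  have cgT : {within K `*` `[0, T]%classic, continuous (fun z : X * R => g z.1 z.2)}.
    apply: continuous_subspaceW cg => -[x t] [/= Kx].
    by rewrite in_itv => /andP[].
  have ne : K `*` `[0, T]%classic !=set0.
    have [x Kx] := K0; exists (x, 0); split => //=.
    by rewrite in_itv /= lexx T0.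
  have [[y s]] := compact_EVT_max ne cKT cgT.
  rewrite inE => -[/= Ky]; rewrite in_itv /= => sT ymax.
  exists y, s; split => // x t Kx tT.
  by apply: (ymax (x, t)); rewrite inE; split => //=; rewrite in_itv.
have [y0 [s0 [Ky0 s00 max0]]] := attained f 0 (lexx 0) cf.
exists (f y0 s0) => x t Kx t0; rewrite leNgt; apply/negP => Mlt.
set M := f y0 s0 in Mlt max0.
have T0 : 0 < t + 1 by lra.
have [y1 [s1 [Ky1 s1T max1]]] := attained f (t + 1) (ltW T0) cf.
set B := f y1 s1 in max1.
have ftB : f x t <= B by apply: max1 => //; apply/andP; split; lra.
(* With this height, f - h <= B - A = M - 1 at the final time s = t + 1. *)
pose A := B - M + 1; have A0 : 0 < A by rewrite /A; lra.
(* The penalty A (s / (t + 1))^n is steep enough to keep the maximum away from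
   s = t + 1, yet negligible at s = t once n is large. *)
have [n hn] : exists n : nat, A * (t / (t + 1)) ^+ n.+1 < f x t - M.
  have q1 : `|t / (t + 1)| < 1.
    by rewrite ger0_norm ?divr_ge0 ?(ltW T0) // ltr_pdivrMr // mul1r; lra.
  have := cvg_expr q1.
  move=> /(@cvgr_lt _ _ _ _ _ 0)/(_ ((f x t - M) / A)).
  rewrite divr_gt0 ?subr_gt0 // => /(_ isT)[N _ hN].
  exists N; have /= := hN N.+1 (leqnSn N).
  by rewrite ltr_pdivlMr // mulrC.
(* The exponent [n.+1] is positive even for n = 0, so h vanishes at time 0 and f - h keeps the
   initial bound M. *)
pose h s := A * (s / (t + 1)) ^+ n.+1.
pose h' s := A * (n.+1%:R * (s / (t + 1)) ^+ n * (t + 1)^-1).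
have dh s : is_derive s (1 : R) h (h' s).
  have -> : h = A \*: ((fun s => s / (t + 1)) ^+ n.+1).
    by apply/funext => z; rewrite /h /= fctE.
  have d1 : is_derive s (1 : R) (fun s => s / (t + 1)) (t + 1)^-1.
    have -> : (fun s => s / (t + 1)) = (t + 1)^-1 \*: (@id R).
      by apply/funext => z; rewrite /= mulrC.
    apply: is_derive_eq (is_deriveZ _ (is_derive_id _ _)) _.
    by rewrite scale_mulE mulr1.
  apply: is_derive_eq (is_deriveZ _ (is_deriveX n.+1 d1)) _.
  by rewrite !scale_mulE.
have ch : continuous h.
  by move=> s; apply/differentiable_continuous/derivable1_diffP; case: (dh s).
have ch' : continuous h'.
  have cq : continuous (fun s : R => s / (t + 1)).
    by apply: continuous_mul; [move=> s; exact: cvg_id|exact: continuous_const].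
  have cqn : continuous (fun s : R => (s / (t + 1)) ^+ n).
    move=> s; apply: (@continuous_comp _ _ _ (fun s : R => s / (t + 1))
      (fun z : R => z ^+ n)); [exact: cq|exact: exprn_continuous].
  exact: (continuous_mul (@continuous_const _ _ A) (continuous_mul
    (continuous_mul (@continuous_const _ _ _) cqn) (@continuous_const _ _ _))).
have cfh : {within K `*` [set t : R | 0 <= t],
    continuous (fun z : X * R => f z.1 z.2 - h z.2)}.
  have ch2 : {within K `*` [set t : R | 0 <= t], continuous (fun z : X * R => h z.2)}.
    by apply: continuous_subspaceT; exact: continuous_comp_snd.
  by move=> z; apply: cvgB; [exact: cf|exact: ch2].
have [y [s [Ky /andP[s0' sT] ymax]]] := attained (fun x t => f x t - h t) (t + 1) (ltW T0) cfh.
have tT : 0 <= t <= t + 1 by apply/andP; split; lra.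
(* By the choice of n the maximum of f - h exceeds M, which rules out both s = 0 and s = t + 1. *)
have Mfh : M < f y s - h s.
  by apply: lt_le_trans (ymax x t Kx tT); rewrite ltrBrDr -ltrBrDl.
have spos : 0 < s.
  rewrite lt_neqAle s0' andbT; apply/eqP => s00'.
  have := max0 y 0 Ky; rewrite lexx => /(_ isT) fM.
  move: Mfh; rewrite -s00' /h mul0r expr0n mulr0 subr0; lra.
have sltT : s < t + 1.
  rewrite lt_neqAle sT andbT; apply/eqP => sE.
  have fB : f y s <= B by apply: max1 => //; rewrite s0' sT.
  move: Mfh; rewrite {2}sE /h divff ?gt_eqF // expr1n mulr1 /A; lra.
apply: (nomax h h' y s) => //.
  by rewrite /h' !mulr_ge0 ?exprn_ge0 ?divr_ge0 ?invr_ge0 ?(ltW A0) ?(ltW T0).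
(* Since s < t + 1 strictly, nearby times stay in the slab over which (y, s) is a maximum. *)
have near_s : \forall z \near nbhs (y, s), z.2 < t + 1.
  have c2 : z.2 @[z --> nbhs (y, s)] --> s by exact: cvg_snd.
  exact: cvgr_lt c2 _ sltT.
apply: filterS near_s => -[x' t'] /= t'T [/= Kx' t'0].
by apply: ymax => //; rewrite (ltW t'0) (ltW t'T).
Qed.

End MaximumPrinciple.

(** * Linear growth bounds for the solution *)

Section Growth.
Variable R : realType.
Variables (r1 r2 : R).
Hypotheses (hr1 : 0 < r1) (hr12 : r1 < r2).
Variables (c u0 : 'rV[R]_2 -> R) (u : 'rV[R]_2 -> R -> R).
Local Notation W := (annulus r1 r2).
Hypothesis hu : spiral_solution W (annulus_normal r1 r2) c u0 u.
Hypothesis c_ge0 : forall x, closure W x -> 0 <= c x.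

Let b := (r1 ^+ 2 + r2 ^+ 2) / 2.

(** Lets the perturbation s g be absorbed into the additive constant of the growth bounds; it
    follows from [radial_bound], as g is the square of a quarter of [radial b x]. *)
Lemma barrier_bounds x : closure W x -> 0 <= barrier b x <= r2 ^+ 4.
Proof.
move=> /(radial_bound hr1 hr12); rewrite -/b /radial normrM ger0_norm //.
rewrite ler_pM2l // => h; rewrite sqr_ge0 /= /barrier -real_normK ?num_real //.
have -> : r2 ^+ 4 = (r2 ^+ 2) ^+ 2 by ring.
by rewrite ler_sqr ?nnegrE // sqr_ge0.
Qed.

Lemma continuous_drift (a s : R) :
  continuous (fun z : 'rV[R]_2 * R => a * z.2 + s * barrier b z.1).
Proof.
have h : continuous (fun z : 'rV[R]_2 * R => z.2) by move=> z; exact: cvg_snd.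
exact: (continuous_add (continuous_mul (@continuous_const _ _ a) h)
  (continuous_mul (@continuous_const _ _ s)
    (continuous_comp_fst (@continuous_barrier _ b)))).
Qed.

Lemma is_derive_drift (a e : R) (h h' : R -> R) :
  (forall t, is_derive t (1 : R) h (h' t)) ->
  forall t, is_derive t (1 : R) (fun t => a * t + e * h t) (a + e * h' t).
Proof.
move=> dh t; have d1 := is_deriveZ a (is_derive_id t (1 : R)).
apply: is_derive_eq (is_deriveD d1 (is_deriveZ e (dh t))) _.
by rewrite !scale_mulE mulr1.
Qed.

(** The slope m + e exceeds the operator bound m + s C, so (m + e) t + s g is a strict
    supersolution, and u minus it has no maximum at a positive time. *)
Lemma solution_le m e : (forall x, closure W x -> c x / enorm x <= m) -> 0 < e ->
  exists M, forall x t, closure W x -> 0 <= t -> u x t <= (m + e) * t + M.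
Proof.
move=> hm e0; have [ucont usub _ _] := hu.
have [x0 x0W] := annulus_nonempty hr1 hr12.
have m0 : 0 <= m.
  by apply: le_trans (hm x0 x0W); rewrite divr_ge0 ?c_ge0 ?sqrtr_ge0.
pose C := 20 * r2 ^+ 2 + m * (4 * r2 ^+ 4).
have C0 : 0 <= C by rewrite addr_ge0 ?mulr_ge0 ?exprn_ge0 // ltW // (lt_trans hr1).
(* The [+ 1] keeps the denominator positive knowing only C >= 0, and makes s C < e strict. *)
pose s := e / (C + 1).
have s0 : 0 < s by rewrite divr_gt0 // ltr_wpDl.
have sC : s * C < e.
  by rewrite /s mulrAC ltr_pdivrMr ?ltr_wpDl // ltr_pM2l // ltrDl.
pose f x t := u x t - ((m + e) * t + s * barrier b x).
have [|h h' x t dh ch' h't xW t0 tmax|M hM] :=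
    @bounded_of_no_interior_max R _ (closure W) f (@closure_annulus_compact R r1 r2).
- have cd : {within closure W `*` [set t | 0 <= t],
      continuous (fun z : 'rV[R]_2 * R => (m + e) * z.2 + s * barrier b z.1)}.
    by apply: continuous_subspaceT; exact: continuous_drift.
  by move=> z; apply: cvgB; [exact: ucont|exact: cd].
- have cd' : continuous (fun t => (m + e) + 1 * h' t).
    exact: (continuous_add (@continuous_const _ _ _)
      (continuous_mul (@continuous_const _ _ _) ch')).
  have phiC := @C21_barrier _ W b s _ _ (is_derive_drift (m + e) 1 dh) cd'.
  have := usub _ _ _ _ phiC x t (conj xW t0).
  case=> [||[nW]].
  + apply: filterS tmax => z /=; rewrite /f mul1r; lra.
  (* Equation alternative: it would give m + e + h' <= m + s C, against s C < e and h' >= 0. *)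
  + have p0 : s *: Dbarrier b x - Dtheta x != 0 := barrier_slope_neq0 hr1 s xW.
    rewrite /mcf_upper (negbTE p0) lee_fin mul1r => hop.
    have /andP[_] := mcf_op_barrier_bounds hr1 hr12 s xW (c_ge0 xW).
    rewrite -/b gtr0_norm // => hop2.
    have cm : c x / enorm x * (4 * r2 ^+ 4) <= m * (4 * r2 ^+ 4).
      by rewrite ler_wpM2r ?hm // mulr_ge0 // exprn_ge0 // ltW // (lt_trans hr1).
    have := ler_wpM2l (ltW s0) cm; have := hm x xW.
    move: sC; rewrite /C; lra.
  (* Neumann alternative: the normal component is s k > 0. *)
  + have [k k0 ->] := dot_barrier_normal hr1 hr12 xW nW.
    by rewrite leNgt mulr_gt0.
- exists (M + s * r2 ^+ 4) => x t xW t0.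
  have /andP[_ bx] := barrier_bounds xW.
  have := hM x t xW t0; have := ler_wpM2l (ltW s0) bx; rewrite /f; lra.
Qed.

(** Mirror image with the strict subsolution (m - e) t - s g: reversing the sign of the perturbation
    makes the Neumann alternative of supersolutions fail. *)
Lemma solution_ge m e : (forall x, closure W x -> m <= c x / enorm x) -> 0 < e ->
  exists M, forall x t, closure W x -> 0 <= t -> (m - e) * t - M <= u x t.
Proof.
move=> hm e0; have [ucont _ usup _] := hu.
(* Only the curvature error enters, because |p| >= 1 / |x| favours the lower bound. *)
pose C := 20 * r2 ^+ 2.
have C0 : 0 <= C by rewrite mulr_ge0 ?exprn_ge0 // ltW // (lt_trans hr1).
pose s := e / (C + 1).
have s0 : 0 < s by rewrite divr_gt0 // ltr_wpDl.
have sC : s * C < e.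
  by rewrite /s mulrAC ltr_pdivrMr ?ltr_wpDl // ltr_pM2l // ltrDl.
(* The order of subtraction turns a maximum of f - h into a minimum of u minus the test function (m
   - e) t - h - s g. *)
pose f x t := (m - e) * t + (- s) * barrier b x - u x t.
have [|h h' x t dh ch' h't xW t0 tmin|M hM] :=
    @bounded_of_no_interior_max R _ (closure W) f (@closure_annulus_compact R r1 r2).
- have cd : {within closure W `*` [set t | 0 <= t],
      continuous (fun z : 'rV[R]_2 * R => (m - e) * z.2 + (- s) * barrier b z.1)}.
    by apply: continuous_subspaceT; exact: continuous_drift.
  by move=> z; apply: cvgB; [exact: cd|exact: ucont].
- have cd' : continuous (fun t => (m - e) + (-1) * h' t).
    exact: (continuous_add (@continuous_const _ _ _)
      (continuous_mul (@continuous_const _ _ _) ch')).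
  have phiC := @C21_barrier _ W b (- s) _ _ (is_derive_drift (m - e) (-1) dh) cd'.
  have := usup _ _ _ _ phiC x t (conj xW t0).
  case=> [||[nW]].
  + apply: filterS tmin => z /=; rewrite /f mulN1r; lra.
  + have p0 : (- s) *: Dbarrier b x - Dtheta x != 0 :=
      barrier_slope_neq0 hr1 (- s) xW.
    rewrite /mcf_lower (negbTE p0) lee_fin mulN1r => hop.
    have /andP[+ _] := mcf_op_barrier_bounds hr1 hr12 (- s) xW (c_ge0 xW).
    rewrite -/b normrN gtr0_norm // => hop2.
    have := hm x xW; move: sC; rewrite /C; lra.
  + have [k k0 ->] := dot_barrier_normal hr1 hr12 xW nW.
    by rewrite mulNr oppr_ge0 leNgt mulr_gt0.
- exists (M + s * r2 ^+ 4) => x t xW t0.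
  have /andP[_ bx] := barrier_bounds xW.
  have := hM x t xW t0; have := ler_wpM2l (ltW s0) bx; rewrite /f; lra.
Qed.

End Growth.

(** * From linear growth bounds to the asymptotic speed *)

Lemma slope_limit_le (R : realType) (F : R -> R) (S a M : R) :
  t^-1 * F t @[t --> +oo] --> S -> (forall t, 0 < t -> F t <= a * t + M) -> S <= a.
Proof.
move=> hS hF; rewrite leNgt; apply/negP => aS.
(* Half the gap S - a suffices: once t exceeds M divided by it, F t > a t + M. *)
have e0 : 0 < (S - a) / 2 by lra.
have near1 : \forall t \near +oo, a + (S - a) / 2 < t^-1 * F t.
  by apply: cvgr_gt hS _ _; lra.
have near2 : \forall t \near +oo, Num.max 1 (M / ((S - a) / 2)) < t.
  by apply: nbhs_pinfty_gt; rewrite num_real.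
have [t [h1]] := filter_ex (filterI near1 near2).
rewrite gt_max ltr_pdivrMr // => /andP[t1 h2].
have t0 : 0 < t by lra.
have := hF t t0; rewrite leNgt => /negP; apply.
move: h1; rewrite [t^-1 * _]mulrC ltr_pdivlMr //; lra.
Qed.

Lemma slope_limit_ge (R : realType) (F : R -> R) (S a M : R) :
  t^-1 * F t @[t --> +oo] --> S -> (forall t, 0 < t -> a * t - M <= F t) -> a <= S.
Proof.
move=> /cvgN hS hF; rewrite -lerN2; apply: (@slope_limit_le _ (fun t => - F t) _ _ M).
  by under eq_fun do rewrite mulrN.
by move=> t /hF; lra.
Qed.

Theorem lemma1p6 (R : realType) (r1 r2 : R) (hr1 : 0 < r1) (hr12 : r1 < r2)
  (c : 'rV[R]_2 -> R) (Dc : 'rV[R]_2 -> 'rV[R]_2)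
  (hc : C1_closure (annulus r1 r2) c Dc)
  (hcpos : forall x, closure (annulus r1 r2) x -> 0 < c x)
  (u0 : 'rV[R]_2 -> R) (Du0 : 'rV[R]_2 -> 'rV[R]_2) (D2u0 : 'rV[R]_2 -> 'M[R]_2)
  (hu0 : C2_closure (annulus r1 r2) u0 Du0 D2u0)
  (hu0n : forall x, (closure (annulus r1 r2) `\` annulus r1 r2) x ->
     dot (Du0 x - Dtheta x) (annulus_normal r1 r2 x) = 0)
  (u : 'rV[R]_2 -> R -> R)
  (hu : spiral_solution (annulus r1 r2) (annulus_normal r1 r2) c u0 u)
  (Sc : R)
  (hSc : t^-1 * max_on (closure (annulus r1 r2)) (u^~ t) @[t --> +oo] --> Sc) :
  min_on (closure (annulus r1 r2)) (fun x => c x / enorm x) <= Sc /\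
  Sc <= max_on (closure (annulus r1 r2)) (fun x => c x / enorm x).
Proof.
set W := closure (annulus r1 r2).
have [x0 x0W] := annulus_nonempty hr1 hr12.
have c0 x : W x -> 0 <= c x by move=> /hcpos/ltW.
have cmax x : W x -> c x / enorm x <= max_on W (fun x => c x / enorm x).
  move=> xW; apply: ub_le_sup; last by exists x.
  have [cc _ _] := hc.
  have [y] := compact_EVT_max (ex_intro _ x0 x0W) (@closure_annulus_compact R r1 r2) cc.
  (* A finite upper bound ensures that [sup] is a genuine supremum: c is at most its maximum c y,
     and 1 / |z| at most 1 / r1. *)
  rewrite inE => yW ymax; exists (c y / r1) => _ [z zW <-].
  have /andP[z1 _] := closure_annulus_sub zW.
  apply: ler_pM; rewrite ?c0 ?invr_ge0 ?sqrtr_ge0 //; first by apply: ymax; rewrite inE.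
  by rewrite lef_pV2 ?posrE // (lt_le_trans hr1).
have cmin x : W x -> min_on W (fun x => c x / enorm x) <= c x / enorm x.
  move=> xW; apply: ge_inf; last by exists x.
  by exists 0 => _ [z zW <-]; rewrite divr_ge0 ?c0 ?sqrtr_ge0.
split; apply/ler_addgt0Pr => e e0.
- have [M hM] := solution_ge hr1 hr12 hu c0 cmin e0.
  (* The upper growth bound makes the values of u at time t bounded above, so that [max_on]
     dominates u x0 t. *)
  have [M' hM'] := solution_le hr1 hr12 hu c0 cmax e0.
  rewrite -lerBlDr; apply: slope_limit_ge hSc _ => t t0.
  apply: le_trans (hM x0 t x0W (ltW t0)) _.
  apply: ub_le_sup; last by exists x0.
  exists ((max_on W (fun x => c x / enorm x) + e) * t + M') => _ [z zW <-].
  exact: hM' (ltW t0).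
- have [M hM] := solution_le hr1 hr12 hu c0 cmax e0.
  apply: slope_limit_le hSc _ => t t0; apply: ge_sup; first by exists (u x0 t), x0.
  by move=> _ [z zW <-]; exact: hM (ltW t0).
Qed.
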